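(* Suppose $f+R$ satisfies the Kurdyka–Łojasiewicz condition with constant $\mu>0$: for all $x\in\mathbb{R}^d$ and $u\in\partial R(x)$, $\|\nabla f(x)+u\|^2\ge2\mu(f(x)+R(x)-f^\star-R^\star)$, where $f^\star=f(x^\star)$, $R^\star=R(x^\star)$ for a minimizer $x^\star$ of $f+R$. In DIANA (i.e., EF-BV with $\nu=1$) with compressors in $\mathbb{C}(\eta,\omega)$, suppose $\lambda\in(0,1]$ is such that $r<1$ and $$0<\gamma\le\frac{1}{2L+\tilde L\sqrt{\frac{r_{\mathrm{av}}}{r}}\frac1{s^\star}}.$$ For $t\ge0$ let $\Psi^t=f(x^t)+R(x^t)-f^\star-R^\star+\frac{\gamma}{2\theta^\star}\frac1n\sum_{i=1}^n\|\nabla f_i(x^t)-h_i^t\|^2$. Then for every $t\ge0$, $\mathbb{E}[\Psi^t]\le\big(\max(\frac{1}{1+\frac12\gamma\mu},\frac{r+1}{2})\big)^t\Psi^0$.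
   Context: $f=\frac1n\sum_if_i$, each $f_i:\mathbb{R}^d\to\mathbb{R}$ convex and $L_i$-smooth; $\tilde L=\sqrt{\frac1n\sum_iL_i^2}$; $f$ is $L$-smooth with $L\le\tilde L$; $R:\mathbb{R}^d\to\mathbb{R}\cup\{+\infty\}$ proper closed convex, $\mathrm{prox}_{\gamma R}(x)=\arg\min_y(\gamma R(y)+\frac12\|x-y\|^2)$; a minimizer of $f+R$ exists. For $\eta\in[0,1)$, $\omega\ge0$, $\mathbb{C}(\eta,\omega)$ is the class of randomized operators $\mathcal{C}:\mathbb{R}^d\to\mathbb{R}^d$ with $\|\mathbb{E}[\mathcal{C}(x)]-x\|\le\eta\|x\|$ and $\mathbb{E}\|\mathcal{C}(x)-\mathbb{E}[\mathcal{C}(x)]\|^2\le\omega\|x\|^2$ for all $x$. Compressors $\mathcal{C}_i^t$ all lie in $\mathbb{C}(\eta,\omega)$, those at iteration $t$ are independent of previous randomness, and $\omega_{\mathrm{av}}\in[0,\omega]$ satisfies $\mathbb{E}\|\frac1n\sum_i(\mathcal{C}_i^t(x_i)-\mathbb{E}[\mathcal{C}_i^t(x_i)])\|^2\le\frac{\omega_{\mathrm{av}}}{n}\sum_i\|x_i\|^2$ for all $t$ and $x_1,\dots,x_n$. DIANA: given $x^0,h_1^0,\dots,h_n^0$, $\gamma>0$, $\lambda\in(0,1]$, $h^0=\frac1n\sum_ih_i^0$; for $t\ge0$: $d_i^t=\mathcal{C}_i^t(\nabla f_i(x^t)-h_i^t)$, $h_i^{t+1}=h_i^t+\lambda d_i^t$,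 $d^t=\frac1n\sum_id_i^t$, $h^{t+1}=h^t+\lambda d^t$, $g^{t+1}=h^t+d^t$, $x^{t+1}=\mathrm{prox}_{\gamma R}(x^t-\gamma g^{t+1})$. Constants: $r=(1-\lambda+\lambda\eta)^2+\lambda^2\omega$, $r_{\mathrm{av}}=\eta^2+\omega_{\mathrm{av}}$, $s^\star=\sqrt{\frac{1+r}{2r}}-1$, $\theta^\star=s^\star(1+s^\star)\frac{r}{r_{\mathrm{av}}}$ (with $r>0$, $r_{\mathrm{av}}>0$). *)

(* Defs.v *)
From HB Require Import structures.
From mathcomp Require Import all_boot all_order all_algebra.
From mathcomp Require Import all_classical all_reals all_analysis.
Set Implicit Arguments. Unset Strict Implicit. Unset Printing Implicit Defensive.
Import Order.TTheory GRing.Theory Num.Theory.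
Import numFieldNormedType.Exports.
Local Open Scope classical_set_scope.
Local Open Scope ring_scope.

Section Defs.
Variables (R : realType) (d : nat).
Notation vec := 'rV[R]_d.

Definition dotv (u v : vec) : R := \sum_(j < d) u 0 j * v 0 j.
Definition norm2 (v : vec) : R := dotv v v.
Definition enorm (v : vec) : R := Num.sqrt (norm2 v).

Definition has_gradient (f : vec -> R) (g : vec -> vec) : Prop :=
  forall x, differentiable f x /\ forall v, 'd f x v = dotv (g x) v.

Definition convex_fun (f : vec -> R) : Prop :=
  forall (x y : vec) (t : R), 0 <= t <= 1 ->
    f (t *: x + (1 - t) *: y) <= t * f x + (1 - t) * f y.

Definition lipschitz_grad (g : vec -> vec) (L : R) : Prop :=
  forall x y, enorm (g x - g y) <= L * enorm (x - y).

Definition proper_fun (Rf : vec -> \bar R) : Prop :=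
  (forall x, Rf x != -oo%E) /\ (exists x, Rf x != +oo%E).
Definition closed_fun (Rf : vec -> \bar R) : Prop :=
  closed [set p : vec * R | (Rf p.1 <= p.2%:E)%E].
Definition convex_efun (Rf : vec -> \bar R) : Prop :=
  forall (x y : vec) (t : R), 0 <= t <= 1 ->
    (Rf (t *: x + (1 - t) *: y)%R <= t%:E * Rf x + (1 - t)%:E * Rf y)%E.

Definition is_prox (gamma : R) (Rf : vec -> \bar R) (p : vec -> vec) : Prop :=
  forall z y, (gamma%:E * Rf (p z) + (norm2 (z - p z) / 2)%:E
               <= gamma%:E * Rf y + (norm2 (z - y) / 2)%:E)%E.

Definition subdiff (Rf : vec -> \bar R) (x u : vec) : Prop :=
  forall y, (Rf x + (dotv u (y - x))%:E <= Rf y)%E.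

Definition meanv (n : nat) (v : 'I_n -> vec) : vec := n%:R^-1 *: \sum_(i < n) v i.
Definition meanf (n : nat) (fs : 'I_n -> vec -> R) (x : vec) : R :=
  n%:R^-1 * \sum_(i < n) fs i x.
Definition meang (n : nat) (gs : 'I_n -> vec -> vec) (x : vec) : vec :=
  meanv (fun i => gs i x).

Definition Evec (dO : measure_display) (O : measurableType dO)
  (P : probability O R) (F : O -> vec) : vec :=
  \row_j fine (\int[P]_w ((F w) 0 j)%:E)%E.

Definition r_const (lam eta om : R) : R := (1 - lam + lam * eta) ^+ 2 + lam ^+ 2 * om.
Definition rav_const (eta omav : R) : R := eta ^+ 2 + omav.
Definition s_star (r : R) : R := Num.sqrt ((1 + r) / (2 * r)) - 1.
Definition theta_star (r rav : R) : R := s_star r * (1 + s_star r) * (r / rav).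

(* DIANA state: (x^t, (h_i^t)_i, h^t) *)
Definition state (n : nat) : Type := (vec * ('I_n -> vec) * vec)%type.

(* one DIANA step at iteration t with randomness w; C t w i is C_i^t *)
Definition diana_step (dO : measure_display) (O : measurableType dO) (n : nat)
  (gs : 'I_n -> vec -> vec) (C : nat -> O -> 'I_n -> vec -> vec)
  (prox : vec -> vec) (gamma lam : R) (t : nat) (s : state n) (w : O) : state n :=
  let: (x, hs, h) := s in
  let di := fun i => C t w i (gs i x - hs i) in
  let dbar := meanv di in
  (prox (x - gamma *: (h + dbar)), (fun i => hs i + lam *: di i), h + lam *: dbar).

Definition Psi (n : nat) (fs : 'I_n -> vec -> R) (gs : 'I_n -> vec -> vec)
  (Rf : vec -> \bar R) (xstar : vec) (gamma theta : R) (s : state n) : \bar R :=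
  let: (x, hs, _) := s in
  ((meanf fs x)%:E + Rf x - (meanf fs xstar)%:E - Rf xstar
   + (gamma / (2 * theta) * (n%:R^-1 * \sum_(i < n) norm2 (gs i x - hs i)))%:E)%E.

(* EPsi P step Psi k m s = E[Psi^{k+m}] when the state at iteration k is s;
   the randomness of iteration k is drawn from P k, independently of the past. *)
Fixpoint EPsi (dO : measure_display) (O : measurableType dO) (n : nat)
  (P : nat -> probability O R) (step : nat -> state n -> O -> state n)
  (Phi : state n -> \bar R) (k m : nat) (s : state n) : \bar R :=
  match m with
  | 0 => Phi s
  | m'.+1 => (\int[P k]_w EPsi P step Phi k.+1 m' (step k s w))%E
  end.

End Defs.

(* Main.v *)
(* One step from x with gradient error xi, landing at x' = prox (x - gamma (grad f x + xi)),
   is compared with the proximal point u of the whole objective F = f + R at x.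
   By convexity of f and R,
     F x' + (1 - 2 gamma L) |x' - x|^2 / (2 gamma)
       <= F u + |u - x|^2 / (2 gamma) + (gamma / 2) |xi|^2,
   and the Kurdyka-Lojasiewicz inequality at u bounds the excess of
   F u + |u - x|^2 / (2 gamma) over F* by (F x - F* ) / (1 + k) with
   k = min(1, gamma mu / 2); replacing mu by a smaller constant is harmless
   because the claimed rate is at least (1 + r) / 2 >= 1 / 2.
   The step size makes the term in |x' - x|^2 absorb the drift of the gradients
   in the shift errors, and theta* is chosen so that
   theta* r_av + (1 + s* ) r = (1 + r) / 2. *)
Require Import Defs.
From HB Require Import structures.
From mathcomp Require Import all_boot all_order all_algebra.
From mathcomp Require Import all_classical all_reals all_analysis.
From mathcomp Require Import measurable_realfun ring lra.
Import Order.TTheory GRing.Theory Num.Theory.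
Import numFieldNormedType.Exports.
Local Open Scope classical_set_scope.
Local Open Scope ring_scope.

(** * Euclidean inner product, Lipschitz gradients and averages of vectors *)

Section EuclideanSpace.
Set Implicit Arguments. Unset Strict Implicit.
Context {R : realType} {d : nat}.
Implicit Types (u v w x y : 'rV[R]_d) (a c : R).

Lemma dotvC u v : dotv u v = dotv v u.
Proof. by apply: eq_bigr => j _; rewrite mulrC. Qed.

Lemma dotvDl u v w : dotv (u + v) w = dotv u w + dotv v w.
Proof. by rewrite /dotv -big_split; apply: eq_bigr => j _; rewrite mxE mulrDl. Qed.

Lemma dotvZl a u v : dotv (a *: u) v = a * dotv u v.
Proof. by rewrite /dotv mulr_sumr; apply: eq_bigr => j _; rewrite mxE mulrA. Qed.

Lemma dotvNl u v : dotv (- u) v = - dotv u v.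
Proof. by rewrite -scaleN1r dotvZl mulN1r. Qed.

Lemma dotv0l v : dotv 0 v = 0.
Proof. by rewrite -(scale0r v) dotvZl mul0r. Qed.

Lemma dotv0r v : dotv v 0 = 0.
Proof. by rewrite dotvC dotv0l. Qed.

Lemma dotvDr u v w : dotv w (u + v) = dotv w u + dotv w v.
Proof. by rewrite ![dotv w _]dotvC dotvDl. Qed.

Lemma dotvZr a u v : dotv u (a *: v) = a * dotv u v.
Proof. by rewrite ![dotv u _]dotvC dotvZl. Qed.

Lemma dotvNr u v : dotv u (- v) = - dotv u v.
Proof. by rewrite ![dotv u _]dotvC dotvNl. Qed.

Definition dotvE := (dotvDl, dotvDr, dotvNl, dotvNr, dotvZl, dotvZr).

Lemma norm2_ge0 v : 0 <= norm2 v.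
Proof. by apply: sumr_ge0 => j _; exact: sqr_ge0. Qed.

Lemma norm2_eq0 v : norm2 v = 0 -> v = 0.
Proof.
move=> /eqP; rewrite psumr_eq0 => [/allP h|j _]; last exact: sqr_ge0.
apply/rowP => j; rewrite mxE; apply/eqP.
by have := h j (mem_index_enum _); rewrite /= mulf_eq0 orbb.
Qed.

Lemma norm2Z a v : norm2 (a *: v) = a ^+ 2 * norm2 v.
Proof. by rewrite /norm2 dotvZl dotvZr mulrA. Qed.

Lemma norm2N v : norm2 (- v) = norm2 v.
Proof. by rewrite /norm2 dotvNl dotvNr opprK. Qed.

Lemma norm2D u v : norm2 (u + v) = norm2 u + 2 * dotv u v + norm2 v.
Proof. rewrite /norm2 !dotvE (dotvC v u); ring. Qed.

Lemma norm2_subC u v : norm2 (u - v) = norm2 (v - u).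
Proof. by rewrite -norm2N opprB. Qed.

Lemma enorm_ge0 v : 0 <= enorm v.
Proof. exact: sqrtr_ge0. Qed.

Lemma sqr_enorm v : enorm v ^+ 2 = norm2 v.
Proof. by rewrite sqr_sqrtr// norm2_ge0. Qed.

(** Cauchy-Schwarz: the squared norm of [norm2 v *: u - dotv u v *: v] is [norm2 v] times the Gram
    determinant of [u] and [v]. *)
Lemma dotv_le_enorm u v : dotv u v <= enorm u * enorm v.
Proof.
have [/eqP v0|v0] := eqVneq (norm2 v) 0.
  by move/eqP: v0 => /norm2_eq0 ->; rewrite dotv0r mulr_ge0 ?enorm_ge0.
have vp : 0 < norm2 v by rewrite lt0r v0 norm2_ge0.
apply: le_trans (ler_norm _) _.
rewrite -(@ler_pXn2r _ 2)// ?nnegrE ?mulr_ge0 ?enorm_ge0//.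
rewrite exprMn !sqr_enorm real_normK ?num_real//.
have := norm2_ge0 (norm2 v *: u - dotv u v *: v).
have -> : norm2 (norm2 v *: u - dotv u v *: v)
   = norm2 v * (norm2 u * norm2 v - dotv u v ^+ 2).
  rewrite /norm2 !dotvE (dotvC v u); ring.
by rewrite pmulr_rge0// subr_ge0.
Qed.

(** Young's inequality, read off from [0 <= norm2 (s *: u - v)] divided by [s]. *)
Lemma norm2D_le (s : R) u v : 0 < s ->
  norm2 (u + v) <= (1 + s) * norm2 u + (1 + s^-1) * norm2 v.
Proof.
move=> s0; have := norm2_ge0 (s *: u - v).
have -> : norm2 (s *: u - v) = s * (s * norm2 u - 2 * dotv u v + s^-1 * norm2 v).
  rewrite /norm2 !dotvE (dotvC v u); field; exact: lt0r_neq0.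
by rewrite pmulr_rge0// norm2D; lra.
Qed.

Lemma lipschitz_norm2 (g : 'rV[R]_d -> 'rV[R]_d) L x y :
  lipschitz_grad g L -> norm2 (g x - g y) <= L ^+ 2 * norm2 (x - y).
Proof.
move=> gL; rewrite -sqr_enorm -(sqr_enorm (x - y)) -exprMn.
have gLxy := gL x y; have Lxy := le_trans (enorm_ge0 _) gLxy.
by rewrite ler_pXn2r ?nnegrE ?enorm_ge0.
Qed.

Lemma lipschitz_dotv (g : 'rV[R]_d -> 'rV[R]_d) L x y :
  lipschitz_grad g L -> dotv (g x - g y) (x - y) <= L * norm2 (x - y).
Proof.
move=> gL; apply: le_trans (dotv_le_enorm _ _) _.
by rewrite -(sqr_enorm (x - y)) expr2 mulrA ler_wpM2r ?enorm_ge0.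
Qed.

Lemma lipschitz_const_ge0 (g : 'rV[R]_d -> 'rV[R]_d) L x y :
  lipschitz_grad g L -> x != y -> 0 <= L.
Proof.
move=> gL xy; have := le_trans (enorm_ge0 _) (gL x y).
rewrite pmulr_lge0// /enorm sqrtr_gt0 lt0r norm2_ge0 andbT.
by apply: contra xy => /eqP/norm2_eq0/eqP; rewrite subr_eq0.
Qed.

Context {n : nat}.
Lemma meanvD (b1 b2 : 'I_n -> 'rV[R]_d) : meanv (fun i => b1 i + b2 i) = meanv b1 + meanv b2.
Proof. by rewrite /meanv big_split scalerDr. Qed.

Lemma meanvZ c (b1 : 'I_n -> 'rV[R]_d) : meanv (fun i => c *: b1 i) = c *: meanv b1.
Proof. by rewrite /meanv -scaler_sumr !scalerA mulrC. Qed.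

Lemma dotv_meanvl (b1 : 'I_n -> 'rV[R]_d) v :
  dotv (meanv b1) v = n%:R^-1 * \sum_(i < n) dotv (b1 i) v.
Proof.
rewrite /meanv dotvZl; congr (_ * _).
by elim/big_ind2: _ => [|u1 c1 u2 c2 <- <-|//]; rewrite ?dotv0l ?dotvDl.
Qed.

(* The difference of the two sides is the variance of [b1] around its mean. *)
Lemma norm2_meanv_le (b1 : 'I_n -> 'rV[R]_d) : (0 < n)%N ->
  norm2 (meanv b1) <= n%:R^-1 * \sum_(i < n) norm2 (b1 i).
Proof.
move=> n0; have n0' : n%:R != 0 :> R by rewrite pnatr_eq0 -lt0n.
set m := meanv b1; rewrite -subr_ge0.
have -> : n%:R^-1 * \sum_(i < n) norm2 (b1 i) - norm2 m
  = n%:R^-1 * \sum_(i < n) norm2 (b1 i - m).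
  under [in RHS]eq_bigr => i _ do rewrite norm2D dotvNr mulrN norm2N.
  rewrite !big_split /= sumrN -mulr_sumr sumr_const card_ord !mulrDr mulrN.
  rewrite (mulrCA _ 2) -dotv_meanvl -/m -/(norm2 m) -[norm2 m *+ n]mulr_natl.
  by rewrite (mulrA _ n%:R) mulVf// mul1r; lra.
by rewrite mulr_ge0 ?invr_ge0// sumr_ge0// => i _; rewrite norm2_ge0.
Qed.

End EuclideanSpace.

(** * Gradient inequality, subgradients and existence of regularized minimizers *)

Section ConvexAnalysis.
Set Implicit Arguments. Unset Strict Implicit.
Context {R : realType} {d : nat}.
Implicit Types (u v w x y : 'rV[R]_d) (f : 'rV[R]_d -> R) (Rf : 'rV[R]_d -> \bar R).

(** The derivative along [y - x] is the right limit of difference quotients over [0 < h <= 1], and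
    convexity bounds each of them by [f y - f x]. *)
Lemma convex_gradient_le f (g : 'rV[R]_d -> 'rV[R]_d) x y :
  has_gradient f g -> convex_fun f -> f x + dotv (g x) (y - x) <= f y.
Proof.
move=> fg cf; have [df /(_ (y - x)) <-] := fg x.
rewrite -(deriveE _ df) -lerBrDl.
have dd := cvg_dnbhs_at_right (diff_derivable (v := y - x) df).
rewrite [leLHS]/derive -(cvg_lim (@Rhausdorff R) dd); apply: limr_le; first exact: cvgP dd.
near=> h.
have h0 : 0 < h by near: h; exact: nbhs_right_gt.
have h1 : h <= 1 by near: h; exact: nbhs_right_le.
rewrite -[_ *: _]/(h^-1 * (f (h *: (y - x) + x) - f x)).
rewrite mulrC ler_pdivrMr// lerBlDr.
have -> : h *: (y - x) + x = h *: y + (1 - h) *: x.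
  by rewrite scalerBr scalerBl scale1r -addrA (addrC (- _)).
by apply: le_trans (cf y x h _) _; [rewrite (ltW h0) | lra].
Unshelve. all: by end_near.
Qed.

Lemma continuous_norm2B x : continuous (fun v => norm2 (v - x)).
Proof.
apply: continuous_big => [|j _]; first exact: add_continuous.
have cj : continuous (fun v : 'rV[R]_d => (v - x) 0 j).
  rewrite (_ : (fun v => _) = (fun v : 'rV[R]_d => v 0 j - x 0 j)); last first.
    by apply/funext => v; rewrite !mxE.
  by move=> v; apply: (@continuousB _ R^o); [exact: coord_continuous | exact: cst_continuous].
by move=> v; exact: (@continuousM R _ _ _ _ (cj v) (cj v)).
Qed.

(* The quadratic term disappears on testing the bound at points tending to [u]. *)
Lemma subdiff_of_quadratic_bound Rf u (c : 'rV[R]_d) (M : R) :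
  convex_efun Rf -> (forall x, Rf x != -oo%E) -> Rf u \is a fin_num ->
  (forall y, Rf u <= Rf y + (dotv c (y - u) + M * norm2 (y - u))%:E)%E ->
  subdiff Rf u (- c).
Proof.
move=> cR RN Ru qR y; move: (RN y); case Ry : (Rf y) => [b| |]// _; last first.
  by rewrite leey.
move: Ru qR; case Ru : (Rf u) => [a| |]// _ qR.
rewrite dotvNl lee_fin.
apply/ler_addgt0Pr => e e0.
(* [M] may be negative, so its positive part is used. Below, [t <= 1] keeps the test point on the
   segment from [u] to [y], and [t <= e / (M' + 1)] makes the quadratic term at most [t * e]. *)
pose M' := Num.max M 0 * norm2 (y - u); have M'0 : 0 <= M'.
  by rewrite mulr_ge0 ?norm2_ge0// le_max lexx orbT.
pose t := Num.min 1 (e / (M' + 1)).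
have t0 : 0 < t by rewrite lt_min ltr01 divr_gt0// ltr_wpDl.
have t1 : t <= 1 by rewrite ge_min lexx.
have tM : t * M' <= e.
  apply: (@le_trans _ _ (e / (M' + 1) * M')); first by rewrite ler_wpM2r// ge_min lexx orbT.
  by rewrite mulrAC ler_pdivrMr ?ltr_wpDl// ler_wpM2l ?(ltW e0)// lerDl ler01.
have /= := qR (t *: y + (1 - t) *: u).
have -> : t *: y + (1 - t) *: u - u = t *: (y - u).
  by apply/rowP => j; rewrite !mxE; ring.
have : (Rf (t *: y + (1 - t) *: u)%R <= (t * b + (1 - t) * a)%:E)%E.
  by have := cR y u t; rewrite Ry Ru (ltW t0) t1; exact.
move: (RN (t *: y + (1 - t) *: u)); case: (Rf _) => [q| |]// _.
rewrite !lee_fin dotvZr norm2Z => qle.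
have MM : M * (t ^+ 2 * norm2 (y - u)) <= t * (t * M').
  have -> : t * (t * M') = Num.max M 0 * (t ^+ 2 * norm2 (y - u)) by rewrite /M'; ring.
  by apply: ler_wpM2r; [rewrite mulr_ge0 ?norm2_ge0 ?sqr_ge0 | rewrite le_max lexx].
move=> H; have : t * (a - dotv c (y - u)) <= t * (b + e).
  have : t * (t * M') <= t * e by rewrite ler_pM2l.
  lra.
by rewrite ler_pM2l//; lra.
Qed.

(* Minimizes a continuous function over a compact piece of the epigraph of [Rf]. *)
Lemma lsc_regularized_min f Rf x (m r c : R) :
  continuous f -> closed_fun Rf -> (forall x, Rf x != -oo%E) ->
  (forall y, m%:E <= (f y)%:E + Rf y)%E -> Rf x = r%:E -> 0 < c ->
  exists u, Rf u \is a fin_num /\ forall y,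
    ((f u + c * norm2 (u - x))%:E + Rf u <= (f y + c * norm2 (y - x))%:E + Rf y)%E.
Proof.
move=> cf clR RN mle Rx c0.
(* [Rf] is only lower semicontinuous; replacing [Rf v] by a height [t] above it gives a continuous
   objective on the closed epigraph. *)
pose phi (p : 'rV[R]_d * R) : R := f p.1 + c * norm2 (p.1 - x) + p.2.
have cphi : continuous phi.
  have c1 : continuous (fun v => f v + c * norm2 (v - x)).
    move=> v; apply: (@continuousD R R^o _ f (fun v => c * norm2 (v - x)) v (cf v)).
    by apply: (@continuousM R _ (cst c)); [exact: cst_continuous | exact: continuous_norm2B].
  move=> p; apply: (@continuousD R R^o _ (fun p => f p.1 + c * norm2 (p.1 - x)) snd p);
    last exact: cvg_snd.
  by apply: (@continuous_comp _ _ _ fst (fun v => f v + c * norm2 (v - x)));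
    [exact: cvg_fst | exact: c1].
pose M := f x + r.
pose E := [set p : 'rV[R]_d * R | (Rf p.1 <= p.2%:E)%E] `&` phi @^-1` [set t | t <= M].
have clE : closed E.
  apply: closedI => //; apply: preimage_closed; last exact: closed_le.
  by move=> p _; exact: cphi.
(* On [E] the squared distance to [x] is at most [(M - m) / c]; adding 1 avoids a square root, since
   a^2 <= q implies a <= q + 1. *)
pose B := (M - m) / c + 1.
pose K := [set v : 'rV[R]_d | forall i, `[x ord0 i - B, x ord0 i + B]%classic (v ord0 i)].
have cK : compact K.
  apply: (@rV_compact _ _ (fun i => `[x ord0 i - B, x ord0 i + B]%classic)) => i.
  exact: segment_compact.
(* A bound for [f] on the box [K] also confines the heights [t], so [E] lies in a compact
   product. *)
have [Q [_ fQ]] : bounded_set (f @` K).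
  by apply/compact_bounded/continuous_compact => //; exact: continuous_subspaceT.
have {}fQ v : K v -> `|f v| <= Q + 1 by move=> Kv; apply: (fQ (Q + 1)); [lra|exists v].
have EK p : E p -> (K `*` `[m - (Q + 1), M + (Q + 1)]%classic) p.
  case: p => v t [/= Rvt]; rewrite /phi /= => pM.
  have mft : m <= f v + t.
    by rewrite -lee_fin EFinD; apply: le_trans (mle v) _; rewrite leeD2l.
  have nv : norm2 (v - x) <= (M - m) / c by rewrite ler_pdivlMr//; lra.
  have Kv : K v.
    move=> i; rewrite /= in_itv /= -ler_distlC distrC.
    have : (v ord0 i - x ord0 i) ^+ 2 <= (M - m) / c.
      apply: le_trans nv; rewrite /norm2 /dotv (bigD1 i)//= !mxE -expr2 lerDl.
      by apply: sumr_ge0 => j _; exact: sqr_ge0.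
    rewrite /B -real_normK ?num_real//; set a := `|_|; have a0 : 0 <= a by exact: normr_ge0.
    by nra.
  split => //=; rewrite in_itv /=.
  have := fQ _ Kv; rewrite ler_norml => /andP[f1 f2].
  have := mulr_ge0 (ltW c0) (norm2_ge0 (v - x)).
  by move=> ?; apply/andP; split; lra.
have cE : compact E.
  by apply: subclosed_compact EK => //; apply: compact_setX => //; exact: segment_compact.
have Ex : E (x, r).
  by split; rewrite /= ?Rx// /phi /= subrr /norm2 dotv0l mulr0 addr0.
have [|[u t]] := @compact_EVT_min _ R phi E (ex_intro _ _ Ex) cE.
  exact: continuous_subspaceT.
rewrite inE => -[/= Rut utM] umin.
have Ru : Rf u \is a fin_num.
  by rewrite fin_numE RN /=; apply: contraTneq Rut => ->; rewrite -ltNge ltry.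
exists u; split => // y.
have := RN y; case Ry : (Rf y) => [b| |]// _; last by rewrite addey// leey.
move: Ru Rut; case Ru : (Rf u) => [a| |]// _; rewrite !lee_fin => at_.
(* Outside the sublevel set the objective exceeds [M], hence also the minimal value; lowering the
   height from [t] to [Rf u] only helps. *)
have [yM|yM] := leP (phi (y, b)) M.
  have := umin (y, b); rewrite inE /phi /= => /(_ _) H.
  by apply: le_trans (H _); [lra | split; rewrite /= ?Ry].
by move: utM yM; rewrite /phi /=; lra.
Qed.

End ConvexAnalysis.

(** * An inexact proximal gradient step under the Kurdyka-Lojasiewicz condition *)

Section ProximalGradientStep.
Set Implicit Arguments. Unset Strict Implicit.
Context {R : realType} {d : nat}.
Variables (f : 'rV[R]_d -> R) (g : 'rV[R]_d -> 'rV[R]_d) (L : R).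
Variables (Rf : 'rV[R]_d -> \bar R) (Fs gamma mu : R).
Hypothesis (f_cont : continuous f).
Hypothesis (f_grad : forall x y, f x + dotv (g x) (y - x) <= f y).
Hypothesis (g_lip : lipschitz_grad g L).
Hypothesis (Rf_proper : proper_fun Rf).
Hypothesis (Rf_closed : closed_fun Rf).
Hypothesis (Rf_convex : convex_efun Rf).
Hypothesis (Fs_le : forall y, (Fs%:E <= (f y)%:E + Rf y)%E).
Hypothesis (gamma_gt0 : 0 < gamma).

(** The gradient inequality at [y] and Cauchy-Schwarz suffice for the constant [L] in place of the
    sharp L/2; the term 2L in the step-size bound pays for it. *)
Lemma smooth_upper_bound x y :
  f y <= f x + dotv (g x) (y - x) + L * norm2 (y - x).
Proof.
have := f_grad y x; have := lipschitz_dotv y x g_lip.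
by rewrite -(opprB y x) dotvNr dotvDl dotvNl; lra.
Qed.

Lemma prox_fin_num (prox : 'rV[R]_d -> 'rV[R]_d) z :
  is_prox gamma Rf prox -> Rf (prox z) \is a fin_num.
Proof.
move=> pr; have [RN [y0 Ry0]] := Rf_proper.
rewrite fin_numE RN /=; apply/eqP => Rp.
have := pr z y0; rewrite Rp gt0_muley ?lte_fin// addye//.
move: (RN y0) Ry0; case: (Rf y0) => [b| |]// _ _.
Qed.

(** Expanding [norm2 (z - y)] around [prox z] turns minimality into a linear bound with a quadratic
    remainder, which [subdiff_of_quadratic_bound] removes. *)
Lemma prox_subdiff (prox : 'rV[R]_d -> 'rV[R]_d) z :
  is_prox gamma Rf prox -> subdiff Rf (prox z) (gamma^-1 *: (z - prox z)).
Proof.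
move=> pr; have [RN _] := Rf_proper.
rewrite -[_ *: _]opprK; have Rp := prox_fin_num z pr.
apply: (@subdiff_of_quadratic_bound _ _ _ _ _ (gamma^-1 / 2)) => // y.
have := pr z y; move: Rp; case: (Rf (prox z)) => [a| |]// _.
have := RN y; case: (Rf y) => [b| |]// _; last by rewrite addye// leey.
rewrite -!EFinM -!EFinD !lee_fin.
have -> : z - y = (z - prox z) - (y - prox z) by rewrite opprB addrA subrK.
rewrite [norm2 (_ - (_ - _))]norm2D norm2N !dotvNr dotvNl dotvZl.
rewrite -(ler_pM2l gamma_gt0 a) => H.
have -> : gamma * (b + (- (gamma^-1 * dotv (z - prox z) (y - prox z)) +
     gamma^-1 / 2 * norm2 (y - prox z)))
  = gamma * b - dotv (z - prox z) (y - prox z) + norm2 (y - prox z) / 2.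
  by field; exact: lt0r_neq0.
lra.
Qed.

(** [u] minimizes f + R + |. - x|^2 / (2c). Bounding [f] above by its linearization at [u] plus a
    quadratic leaves a subgradient of [Rf] alone; adding [g u] to it gives [c^-1 *: (x - u)], the
    vector to which the Kurdyka-Lojasiewicz inequality is applied. *)
Lemma proximal_point x (r c : R) : Rf x = r%:E -> 0 < c ->
  exists u a, Rf u = a%:E /\ subdiff Rf u (c^-1 *: (x - u) - g u).
Proof.
move=> Rx c0; have [RN _] := Rf_proper.
have c2 : 0 < (2 * c)^-1 by rewrite invr_gt0 mulr_gt0.
have [u [Ru umin]] := lsc_regularized_min f_cont Rf_closed RN Fs_le Rx c2.
exists u, (fine (Rf u)); split; first by rewrite fineK.
rewrite -[_ - g u]opprK.
apply: (@subdiff_of_quadratic_bound _ _ _ _ _ (L + (2 * c)^-1)) => // y.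
have := umin y; move: Ru; case: (Rf u) => [a| |]// _.
have := RN y; case: (Rf y) => [b| |]// _; last by move=> _; rewrite addye// leey.
rewrite -!EFinD !lee_fin => H; have := smooth_upper_bound u y.
move: H; have -> : y - x = (y - u) - (x - u) by rewrite opprB addrA subrK.
rewrite (norm2_subC u x); move: (y - u) (x - u) => w z.
rewrite norm2D norm2N dotvNr opprB dotvDl dotvNl dotvZl (dotvC z).
by have -> : c^-1 = 2 * (2 * c)^-1; [field; exact: lt0r_neq0 | lra].
Qed.

Hypothesis KL : forall x u, subdiff Rf x u ->
  ((2 * mu)%:E * ((f x)%:E + Rf x - Fs%:E) <= (norm2 (g x + u))%:E)%E.

(* Compare with the proximal point of [f + Rf] for the smaller step
   [gamma / (1 + k)]; this is where [k <= 1] is needed. *)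
Lemma moreau_envelope_decrease x (r k : R) : Rf x = r%:E ->
  0 < k <= 1 -> k <= gamma * mu / 2 ->
  exists u a, Rf u = a%:E /\
    f u + a - Fs + norm2 (x - u) / (2 * gamma) <= (1 + k)^-1 * (f x + r - Fs).
Proof.
move=> Rx /andP[k0 k1] kmu.
have k10 : 0 < 1 + k by rewrite addr_gt0.
have c0 : 0 < gamma / (1 + k) by rewrite divr_gt0.
have [u [a [Ru sub]]] := proximal_point Rx c0; exists u, a; split => //.
set c := gamma / (1 + k) in c0 sub.
have [y yE] : exists y, y = c^-1 *: (x - u) by eexists.
have xu : x - u = c *: y by rewrite yE scalerA divff ?scale1r// lt0r_neq0.
rewrite -yE in sub.
have ygE : g u + (y - g u) = y by rewrite addrC subrK.
have := KL sub; rewrite Ru ygE -!EFinD -EFinM lee_fin.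
have := sub x; rewrite Ru Rx -EFinD lee_fin dotvDl dotvNl xu !dotvZr -/(norm2 y).
have := f_grad u x; rewrite xu norm2Z dotvZr.
have := Fs_le u; rewrite Ru -EFinD lee_fin.
set Y := norm2 y; set A := f u + a - Fs => A0 H1 H2 H3.
(* Sum of the convexity inequalities of [f] and [Rf] from [u] to [x = u + c *: y]. *)
have {H1 H2} : A + c * Y <= f x + r - Fs by rewrite /A; lra.
move=> H1; rewrite [leRHS]mulrC ler_pdivlMr//.
apply: le_trans H1.
have cE : gamma = c * (1 + k) by rewrite /c divfK// lt0r_neq0.
have -> : (A + c ^+ 2 * Y / (2 * gamma)) * (1 + k) = A * (1 + k) + c * Y / 2.
  by rewrite cE; field; rewrite !lt0r_neq0.
have Age : 0 <= A by rewrite /A; lra.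
(* [|y|^2 >= 2 mu A >= 4 k A / gamma] *)
have : 4 * k * A <= gamma * Y.
  apply: (@le_trans _ _ (gamma * (2 * mu * A))); last by rewrite ler_pM2l.
  have := ler_wpM2r Age kmu; lra.
rewrite cE => H.
(* Here [1 + k <= 2] is used. Cancelling [1 + k] leaves k A <= c Y / 2, which is the goal without
   its common terms. *)
have : 2 * k * A * (1 + k) <= c * Y * (1 + k).
  apply: (@le_trans _ _ (4 * k * A)); last by rewrite [leRHS]mulrAC.
  have : 0 <= k * A * (1 - k) by rewrite !mulr_ge0 ?subr_ge0// ltW.
  lra.
rewrite ler_pM2r//; lra.
Qed.

(* [xi] is the error made on the gradient at [x]. *)
Lemma inexact_prox_gradient_descent (prox : 'rV[R]_d -> 'rV[R]_d) x xi (r k : R) :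
  is_prox gamma Rf prox -> Rf x = r%:E -> 0 < k <= 1 -> k <= gamma * mu / 2 ->
  let x' := prox (x - gamma *: (g x + xi)) in
  exists2 r', Rf x' = r'%:E &
    f x' + r' - Fs + (1 - 2 * gamma * L) * norm2 (x' - x) / (2 * gamma)
      <= (1 + k)^-1 * (f x + r - Fs) + gamma / 2 * norm2 xi.
Proof.
move=> pr Rx k01 kmu x'.
have [u [a [Ru ule]]] := moreau_envelope_decrease Rx k01 kmu.
have := prox_fin_num (x - gamma *: (g x + xi)) pr; rewrite -/x'.
case Rx' : (Rf x') => [r'| |]// _; exists r' => //.
(* Three inequalities are added: the subgradient inequality of [Rf] at [x'] tested at [u], convexity
   of [f] from [x] to [u], and smoothness of [f] from [x] to [x']. *)
have := prox_subdiff (x - gamma *: (g x + xi)) pr u.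
rewrite -/x' Rx' Ru -EFinD lee_fin.
have := smooth_upper_bound x x'.
have := f_grad x u.
have -> : u - x' = (u - x) - (x' - x) by rewrite opprB addrA subrK.
have -> : x - gamma *: (g x + xi) - x' = - gamma *: (g x + xi) - (x' - x).
  by apply/rowP => j; rewrite !mxE; ring.
rewrite scalerDr scalerA mulrN mulVf ?lt0r_neq0// scaleN1r.
move: ule; rewrite norm2_subC; move: (u - x) (x' - x) => v D ule.
rewrite !dotvE -/(norm2 D).
(* [- <xi, u - x'> <= gamma |xi|^2 / 2 + |u - x'|^2 / (2 gamma)] *)
have := norm2_ge0 (gamma *: xi - (v - D)).
rewrite norm2D norm2Z norm2N norm2D norm2N !dotvE.
have gE (p : R) : gamma^-1 * p = 2 * (p / (2 * gamma)) by field; exact: lt0r_neq0.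
rewrite !gE.
have -> : (1 - 2 * gamma * L) * norm2 D / (2 * gamma) = norm2 D / (2 * gamma) - L * norm2 D.
  by field; exact: lt0r_neq0.
move=> H.
have {}H : 0 <= gamma / 2 * norm2 xi - (dotv xi v - dotv xi D)
    + norm2 v / (2 * gamma) - 2 * (dotv v D / (2 * gamma)) + norm2 D / (2 * gamma).
  have -> : gamma / 2 * norm2 xi - (dotv xi v - dotv xi D)
    + norm2 v / (2 * gamma) - 2 * (dotv v D / (2 * gamma)) + norm2 D / (2 * gamma)
    = (gamma ^+ 2 * norm2 xi + 2 * - (gamma * (dotv xi v - dotv xi D))
      + (norm2 v + 2 * - dotv v D + norm2 D)) / (2 * gamma).
    by field; exact: lt0r_neq0.
  by apply: divr_ge0; [lra | rewrite mulr_ge0// ltW].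
move: ule H; rewrite !(dotvC D).
lra.
Qed.

End ProximalGradientStep.

(** * Expected squared norms of centered random vectors *)

Section RandomVectors.
Set Implicit Arguments. Unset Strict Implicit.
Context {R : realType} {d : nat} {dO : measure_display} {O : measurableType dO}.
Implicit Types (P : probability O R) (N : O -> 'rV[R]_d).

(* Neither function has to be measurable: the integral of a nonnegative
   function is a supremum over the simple functions below it. *)
Lemma ge0_le_integral_nonmeasurable P (f g : O -> \bar R) :
  (forall w, 0 <= f w)%E -> (forall w, f w <= g w)%E ->
  (\int[P]_w f w <= \int[P]_w g w)%E.
Proof.
move=> f0 fg; have g0 w := le_trans (f0 w) (fg w).
rewrite !ge0_integralTE//; apply: le_ereal_sup => _ [h /= hf <-].
by exists h => // w; exact: le_trans (hf w) (fg w).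
Qed.

Lemma probability_integral_cst P (c : R) : (\int[P]_w c%:E = c%:E)%E.
Proof.
rewrite (integral_cst P measurableT c%:E) -[RHS]mule1; congr (_ * _)%E.
exact: probability_setT.
Qed.

Definition centered P N := forall j,
  P.-integrable setT (fun w => (N w 0 j)%:E) /\ (\int[P]_w (N w 0 j)%:E = 0)%E.

Lemma measurable_norm2 N :
  (forall j, measurable_fun setT (fun w => N w 0 j)) ->
  measurable_fun setT (fun w => norm2 (N w)).
Proof. by move=> mN; apply: measurable_sum => j; exact: measurable_funM. Qed.

Lemma integrable_measurable_coord P N j :
  P.-integrable setT (fun w => (N w 0 j)%:E) -> measurable_fun setT (fun w => N w 0 j).
Proof. by move=> /measurable_int/measurable_EFinP. Qed.

Lemma centered_measurable_norm2D P N b :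
  centered P N -> measurable_fun setT (fun w => norm2 (b + N w)).
Proof.
move=> cN; apply: measurable_norm2 => j; under eq_fun do rewrite mxE.
by apply: measurable_funD => //; exact: integrable_measurable_coord (cN j).1.
Qed.

Lemma centered_measurable_norm2 P N :
  centered P N -> measurable_fun setT (fun w => norm2 (N w)).
Proof.
by move=> /centered_measurable_norm2D-/(_ 0); under eq_fun do rewrite add0r.
Qed.

Lemma centered0 P : centered P (fun=> 0).
Proof.
move=> j; under eq_fun do rewrite mxE; split; first exact: integrable0.
exact: integral0.
Qed.

Lemma centeredD P N1 N2 : centered P N1 -> centered P N2 ->
  centered P (fun w => N1 w + N2 w).
Proof.
move=> c1 c2 j; have [i1 e1] := c1 j; have [i2 e2] := c2 j; split.
  by under eq_fun do rewrite mxE EFinD; exact: integrableD.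
by under eq_integral do rewrite mxE EFinD; rewrite integralD// e1 e2 adde0.
Qed.

Lemma centeredZ P N (a : R) : centered P N -> centered P (fun w => a *: N w).
Proof.
move=> c1 j; have [i1 e1] := c1 j; split.
  by under eq_fun do rewrite mxE EFinM; exact: integrableZl.
by under eq_integral do rewrite mxE EFinM; rewrite integralZl// e1 mule0.
Qed.

Lemma centered_meanv P n (N : 'I_n -> O -> 'rV[R]_d) :
  (forall i, centered P (N i)) -> centered P (fun w => meanv (fun i => N i w)).
Proof.
move=> cN; apply: centeredZ; elim: (index_enum _) => [|i s ih].
  by under eq_fun do rewrite big_nil; exact: centered0.
by under eq_fun do rewrite big_cons; exact: centeredD.
Qed.

Lemma centered_subE P N : (forall j, P.-integrable setT (fun w => (N w 0 j)%:E)) ->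
  centered P (fun w => N w - Evec P N).
Proof.
move=> iN j; have fN := integrable_fin_num measurableT (iN j).
have ic : P.-integrable setT (EFin \o cst (Evec P N 0 j)) by exact: finite_measure_integrable_cst.
have NE w : ((N w - Evec P N) 0 j)%:E = ((N w 0 j)%:E - (Evec P N 0 j)%:E)%E by rewrite !mxE.
split; first by under eq_fun do rewrite NE; exact: integrableB.
under eq_integral do rewrite NE.
rewrite integralB//= probability_integral_cst.
by rewrite mxE fineK// subee.
Qed.

Lemma integral_dotv_centered P N b : centered P N ->
  P.-integrable setT (fun w => (dotv b (N w))%:E) /\ (\int[P]_w (dotv b (N w))%:E = 0)%E.
Proof.
move=> cN; have dE w : ((dotv b (N w))%:E = \sum_(j < d) (b 0 j)%:E * (N w 0 j)%:E)%E.
  by rewrite -sumEFin; apply: eq_bigr => j _; rewrite EFinM.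
have ij j : P.-integrable setT (fun w => (b 0 j)%:E * (N w 0 j)%:E)%E.
  by apply: integrableZl => //; exact: (cN j).1.
split; first by under eq_fun do rewrite dE; exact: integrable_sum.
under eq_integral do rewrite dE; rewrite integral_sum//.
by apply: big1 => j _; rewrite integralZl// ?(cN j).2 ?mule0//; exact: (cN j).1.
Qed.

(* The cross term of the bias-variance decomposition integrates to zero. *)
Lemma integral_norm2_centered_le P N b (K : R) : centered P N ->
  (\int[P]_w (norm2 (N w))%:E <= K%:E)%E ->
  (\int[P]_w (norm2 (b + N w))%:E <= (norm2 b + K)%:E)%E.
Proof.
move=> cN NK; have [il el] := integral_dotv_centered (2 *: b) cN.
have iN : P.-integrable setT (fun w => (norm2 (N w))%:E).
  apply/integrableP; split; first by apply/measurable_EFinP; exact: centered_measurable_norm2 cN.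
  apply: le_lt_trans (ltry K); apply: le_trans NK.
  by under eq_integral do rewrite /= ger0_norm ?norm2_ge0//.
have ic : P.-integrable setT (EFin \o cst (norm2 b)) by exact: finite_measure_integrable_cst.
have bE w : (norm2 (b + N w))%:E =
    ((norm2 b)%:E + (dotv (2 *: b) (N w))%:E + (norm2 (N w))%:E)%E.
  by rewrite norm2D dotvZl.
under eq_integral do rewrite bE.
rewrite integralD//; last exact: integrableD.
rewrite integralD//= el adde0 probability_integral_cst.
by rewrite EFinD leeD2l.
Qed.

Lemma integral_norm2Z_le P N (a K : R) : centered P N ->
  (\int[P]_w (norm2 (N w))%:E <= K%:E)%E ->
  (\int[P]_w (norm2 (a *: N w))%:E <= (a ^+ 2 * K)%:E)%E.
Proof.
move=> cN NK; under eq_integral do rewrite norm2Z EFinM.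
rewrite ge0_integralZl_EFin ?sqr_ge0//.
- by rewrite [leRHS]EFinM; apply: lee_wpmul2l; rewrite ?lee_fin ?sqr_ge0.
- by move=> w _; rewrite lee_fin norm2_ge0.
- by apply/measurable_EFinP; exact: centered_measurable_norm2 cN.
Qed.

(** Carries the separate bounds on the expected squared errors through a pointwise affine estimate;
    nonnegativity of all terms lets the integral split without integrability. *)
Lemma integral_affine_le P n (f : O -> R) (h : 'I_n -> O -> R) (A p q F : R) (H : 'I_n -> R) :
  0 <= A -> 0 <= p -> 0 <= q ->
  (forall w, 0 <= f w) -> measurable_fun setT f -> (\int[P]_w (f w)%:E <= F%:E)%E ->
  (forall i w, 0 <= h i w) -> (forall i, measurable_fun setT (h i)) ->
  (forall i, \int[P]_w (h i w)%:E <= (H i)%:E)%E ->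
  (\int[P]_w (A + p * f w + q * \sum_(i < n) h i w)%:E
    <= (A + p * F + q * \sum_(i < n) H i)%:E)%E.
Proof.
move=> A0 p0 q0 f0 mf fF h0 mh hH.
have E1 w : (A + p * f w + q * \sum_(i < n) h i w)%:E =
    (A%:E + p%:E * (f w)%:E + q%:E * \sum_(i < n) (h i w)%:E)%E.
  by rewrite sumEFin !EFinD !EFinM.
under eq_integral do rewrite E1.
have mf' : measurable_fun setT (fun w => (f w)%:E) by exact/measurable_EFinP.
have mh' i : measurable_fun setT (fun w => (h i w)%:E) by exact/measurable_EFinP.
have ms : measurable_fun setT (fun w => \sum_(i < n) (h i w)%:E)%E by exact: emeasurable_sum.
have s0 w : (0 <= \sum_(i < n) (h i w)%:E)%E by apply: sume_ge0 => i _; rewrite lee_fin.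
have mZ (k : R) (u : O -> \bar R) : measurable_fun setT u ->
  measurable_fun setT (fun w => k%:E * u w)%E by move=> mu; exact: emeasurable_funM.
have pf0 w : [set: O] w -> (0 <= p%:E * (f w)%:E)%E by move=> _; rewrite mule_ge0 ?lee_fin.
have qh0 w : [set: O] w -> (0 <= q%:E * \sum_(i < n) (h i w)%:E)%E.
  by move=> _; rewrite mule_ge0 ?lee_fin.
have Apf0 w : [set: O] w -> (0 <= A%:E + p%:E * (f w)%:E)%E.
  by move=> Ow; apply: adde_ge0; [rewrite lee_fin | exact: pf0].
have mpf := mZ p _ mf'; have mqh := mZ q _ ms.
have mApf : measurable_fun setT (fun w => A%:E + p%:E * (f w)%:E)%E.
  exact: emeasurable_funD.
rewrite ge0_integralD//; rewrite ge0_integralD//.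
have hD0 i w : [set: O] w -> (0 <= (h i w)%:E)%E by rewrite lee_fin.
have fD0 w : [set: O] w -> (0 <= (f w)%:E)%E by rewrite lee_fin.
rewrite !ge0_integralZl_EFin ?ge0_integral_sum//.
rewrite probability_integral_cst.
rewrite !EFinD !EFinM -sumEFin; apply: leeD; first apply: leeD => //.
  by apply: lee_wpmul2l; rewrite ?lee_fin.
by apply: lee_wpmul2l; rewrite ?lee_fin// lee_sum.
Qed.

End RandomVectors.

(** * The constants of the rate, the compression bias and the averaged objective *)

Section Diana.
Set Implicit Arguments. Unset Strict Implicit.
Context {R : realType}.

Lemma s_star_gt0 (r : R) : 0 < r < 1 -> 0 < s_star r.
Proof.
move=> /andP[r0 r1]; rewrite subr_gt0 -{1}sqrtr1 ltr_sqrt; last first.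
  by rewrite divr_gt0 ?mulr_gt0 ?addr_gt0.
by rewrite ltr_pdivlMr ?mulr_gt0//; lra.
Qed.

(** The equation that defines s*: two Young factors 1 + s* raise [r] exactly to the midpoint of [r]
    and 1. *)
Lemma s_star_sqr (r : R) : 0 < r -> (1 + s_star r) ^+ 2 * r = (1 + r) / 2.
Proof.
move=> r0; rewrite /s_star addrC subrK sqr_sqrtr ?divr_ge0 ?mulr_ge0 ?addr_ge0 ?ltW//.
by field; exact: lt0r_neq0.
Qed.

Lemma theta_star_gt0 (r rav : R) : 0 < r < 1 -> 0 < rav -> 0 < theta_star r rav.
Proof.
move=> r01 rav0; have s0 := s_star_gt0 r01; have [r0 _] := andP r01.
by rewrite /theta_star mulr_gt0 ?divr_gt0// mulr_gt0// addr_gt0.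
Qed.

Lemma theta_star_contraction (r rav : R) : 0 < r < 1 -> 0 < rav ->
  theta_star r rav * rav + (1 + s_star r) * r = (r + 1) / 2.
Proof.
move=> /andP[r0 _] rav0; rewrite [r + 1]addrC -s_star_sqr// /theta_star.
by field; exact: lt0r_neq0.
Qed.

(** With a = sqrt(r_av / r) Lt / s*, the left side is exactly (gamma a)^2 / (2 gamma), and gamma (2L
    + a) <= 1 gives (gamma a)^2 <= gamma a <= 1 - 2 gamma L. *)
Lemma stepsize_bound (r rav gamma L Lt : R) : 0 < r < 1 -> 0 < rav ->
  0 < gamma -> 0 <= L -> 0 <= Lt ->
  gamma <= (2 * L + Num.sqrt (rav / r) * (s_star r)^-1 * Lt)^-1 ->
  gamma / (2 * theta_star r rav) * ((1 + (s_star r)^-1) * Lt ^+ 2)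
    <= (1 - 2 * gamma * L) / (2 * gamma).
Proof.
move=> r01 rav0 g0 L0 Lt0 gle; have s0 := s_star_gt0 r01; have [r0 _] := andP r01.
set a := Num.sqrt (rav / r) * (s_star r)^-1 * Lt in gle.
have a0 : 0 <= a by rewrite !mulr_ge0 ?sqrtr_ge0 ?invr_ge0// ltW.
(* As [0^-1 = 0], a positive [gamma] below the inverse forces a positive denominator. *)
have d0 : 0 < 2 * L + a by rewrite -invr_gt0; exact: lt_le_trans gle.
have ga : gamma * (2 * L + a) <= 1.
  by rewrite -ler_pdivlMr// div1r.
have a2 : a ^+ 2 = rav / r / s_star r ^+ 2 * Lt ^+ 2.
  by rewrite !exprMn sqr_sqrtr ?divr_ge0 ?ltW// exprVn.
have -> : gamma / (2 * theta_star r rav) * ((1 + (s_star r)^-1) * Lt ^+ 2)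
    = (gamma * a) ^+ 2 / (2 * gamma).
  rewrite exprMn a2 /theta_star; field.
  by rewrite !lt0r_neq0// addr_gt0.
rewrite ler_pM2r ?invr_gt0 ?mulr_gt0//.
have gL : 0 <= gamma * L by rewrite mulr_ge0// ltW.
have gA : 0 <= gamma * a by rewrite mulr_ge0// ltW.
apply: (@le_trans _ _ (gamma * a)); last by lra.
rewrite expr2 ler_piMl//; lra.
Qed.

Context {d n : nat}.
Implicit Types (v m x : 'rV[R]_d).

Lemma norm2_bias_le (eta : R) v m : 0 <= eta ->
  enorm (m - v) <= eta * enorm v -> norm2 (m - v) <= eta ^+ 2 * norm2 v.
Proof.
move=> e0 mv.
by rewrite -sqr_enorm -(sqr_enorm v) -exprMn ler_pXn2r ?nnegrE ?mulr_ge0 ?enorm_ge0.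
Qed.

(** Squared triangle inequality for v - lam m = (1 - lam) v - lam (m - v), with Cauchy-Schwarz on
    the cross term. *)
Lemma norm2_sub_scale_le (lam eta : R) v m : 0 <= lam <= 1 -> 0 <= eta ->
  enorm (m - v) <= eta * enorm v ->
  norm2 (v - lam *: m) <= (1 - lam + lam * eta) ^+ 2 * norm2 v.
Proof.
move=> /andP[l0 l1] e0 mv.
have -> : v - lam *: m = (1 - lam) *: v - lam *: (m - v).
  by apply/rowP => j; rewrite !mxE; ring.
rewrite norm2D norm2N !norm2Z dotvNr dotvZl dotvZr.
have n2 := norm2_bias_le e0 mv.
have : - dotv v (m - v) <= eta * norm2 v.
  rewrite -dotvNr; apply: le_trans (dotv_le_enorm _ _) _.
  rewrite /enorm norm2N -!/(enorm _) -sqr_enorm expr2 mulrA mulrC.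
  by rewrite ler_wpM2r ?enorm_ge0.
move=> n1.
have := ler_wpM2l (sqr_ge0 lam) n2.
have := ler_wpM2l (mulr_ge0 (_ : 0 <= 1 - lam) l0) n1.
rewrite subr_ge0 => /(_ l1); lra.
Qed.

Variables (fs : 'I_n -> 'rV[R]_d -> R) (gs : 'I_n -> 'rV[R]_d -> 'rV[R]_d).
Hypotheses (fs_grad : forall i, has_gradient (fs i) (gs i))
  (fs_convex : forall i, convex_fun (fs i)).

Lemma continuous_meanf : continuous (meanf fs).
Proof.
have cs : continuous (fun x => \sum_(i < n) fs i x).
  apply: continuous_big => [|i _ x]; first exact: add_continuous.
  exact: differentiable_continuous (fs_grad i x).1.
by move=> x; apply: (@continuousM R _ (cst n%:R^-1)); [exact: cst_continuous | exact: cs].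
Qed.

Lemma meanf_gradient_le x y :
  meanf fs x + dotv (meang gs x) (y - x) <= meanf fs y.
Proof.
rewrite dotv_meanvl /meanf -mulrDr -big_split ler_wpM2l ?invr_ge0//.
by apply: ler_sum => i _; exact: convex_gradient_le.
Qed.

End Diana.

(** * Expected decrease of the Lyapunov function in one DIANA step *)

Section DianaStep.
Set Implicit Arguments. Unset Strict Implicit.
Context {R : realType} {d n : nat}.
Variables (fs : 'I_n -> 'rV[R]_d -> R) (gs : 'I_n -> 'rV[R]_d -> 'rV[R]_d)
  (Ls : 'I_n -> R) (L : R) (Rf : 'rV[R]_d -> \bar R) (xstar : 'rV[R]_d)
  (eta om omav lam gamma mu : R)
  (dO : measure_display) (O : measurableType dO) (P : nat -> probability O R)
  (C : nat -> O -> 'I_n -> 'rV[R]_d -> 'rV[R]_d) (prox : 'rV[R]_d -> 'rV[R]_d).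

Let EC t i v := Evec (P t) (fun w => C t w i v).
Let Lt := Num.sqrt (n%:R^-1 * \sum_(i < n) Ls i ^+ 2).
Let r := r_const lam eta om.
Let rav := rav_const eta omav.
Let theta := theta_star r rav.
Let rho := Num.max (1 + gamma * mu / 2)^-1 ((r + 1) / 2).
Let Phi := Psi fs gs Rf xstar gamma theta.
Let step := diana_step gs C prox gamma lam.

Hypothesis n_gt0 : (0 < n)%N.
Hypothesis fs_grad : forall i, has_gradient (fs i) (gs i).
Hypothesis fs_convex : forall i, convex_fun (fs i).
Hypothesis gs_lip : forall i, lipschitz_grad (gs i) (Ls i).
Hypothesis g_lip : lipschitz_grad (meang gs) L.
Hypothesis Rf_proper : proper_fun Rf.
Hypothesis Rf_closed : closed_fun Rf.
Hypothesis Rf_convex : convex_efun Rf.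
Hypothesis prox_spec : is_prox gamma Rf prox.
Hypothesis xstar_min :
  forall y, ((meanf fs xstar)%:E + Rf xstar <= (meanf fs y)%:E + Rf y)%E.
Hypothesis eta_bounds : 0 <= eta < 1.
Hypothesis C_int : forall t i x j, (P t).-integrable setT (fun w => ((C t w i x) 0 j)%:E).
Hypothesis C_bias : forall t i x, enorm (EC t i x - x) <= eta * enorm x.
Hypothesis C_var : forall t i x,
  (\int[P t]_w (norm2 (C t w i x - EC t i x))%:E <= (om * norm2 x)%:E)%E.
Hypothesis C_avg_var : forall t (xs : 'I_n -> 'rV[R]_d),
  (\int[P t]_w (norm2 (meanv (fun i => C t w i (xs i) - EC t i (xs i))))%:E
    <= (omav / n%:R * \sum_(i < n) norm2 (xs i))%:E)%E.
Hypothesis r_gt0 : 0 < r.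
Hypothesis rav_gt0 : 0 < rav.
Hypothesis mu_gt0 : 0 < mu.
Hypothesis KL : forall x u, subdiff Rf x u ->
  ((2 * mu)%:E * ((meanf fs x)%:E + Rf x - (meanf fs xstar)%:E - Rf xstar)
    <= (norm2 (meang gs x + u))%:E)%E.
Hypothesis lam_bounds : 0 < lam <= 1.
Hypothesis r_lt1 : r < 1.
Hypothesis gamma_gt0 : 0 < gamma.
Hypothesis gamma_le :
  gamma <= (2 * L + Num.sqrt (rav / r) * (s_star r)^-1 * Lt)^-1.

Lemma Rf_xstar_fin_num : Rf xstar \is a fin_num.
Proof.
have [RN [y Ry]] := Rf_proper.
rewrite fin_numE RN /=; apply/eqP => Rs; have := xstar_min y; rewrite Rs.
by move: (RN y) Ry; case: (Rf y).
Qed.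

Let Fs := meanf fs xstar + fine (Rf xstar).

Lemma Fs_le y : (Fs%:E <= (meanf fs y)%:E + Rf y)%E.
Proof. by rewrite EFinD fineK ?Rf_xstar_fin_num. Qed.

Lemma sub_Fs z : (z - (meanf fs xstar)%:E - Rf xstar = z - Fs%:E)%E.
Proof.
rewrite -[Rf xstar]fineK ?Rf_xstar_fin_num// -addeA -!EFinN -EFinD.
by rewrite /Fs opprD.
Qed.

Let theta_gt0 : 0 < theta.
Proof. by apply: theta_star_gt0 => //; rewrite r_gt0. Qed.

Let rho_gt0 : 0 < rho.
Proof. by rewrite lt_max divr_gt0 ?orbT// addr_gt0. Qed.

Let coef_gt0 : 0 < gamma / (2 * theta).
Proof. by rewrite divr_gt0// mulr_gt0. Qed.

Lemma PsiE x hs h (a : R) : Rf x = a%:E ->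
  Phi (x, hs, h) = (meanf fs x + a - Fs
    + gamma / (2 * theta) * (n%:R^-1 * \sum_(i < n) norm2 (gs i x - hs i)))%:E.
Proof. by move=> Rx; rewrite /Phi /Psi Rx sub_Fs. Qed.

(** Nonnegativity is what allows integrals of [Phi] to be compared without measurability. *)
Lemma Psi_ge0 s : (0 <= Phi s)%E.
Proof.
case: s => [[x hs] h]; have [RN _] := Rf_proper.
have q0 : 0 <= gamma / (2 * theta) * (n%:R^-1 * \sum_(i < n) norm2 (gs i x - hs i)).
  apply: mulr_ge0; first exact: ltW coef_gt0.
  by rewrite mulr_ge0 ?invr_ge0// sumr_ge0// => i _; exact: norm2_ge0.
have := Fs_le x; case Rx : (Rf x) => [a| |]; last 2 first.
- by move=> _; rewrite /Phi /Psi Rx sub_Fs addey// addye// addye// leey.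
- by have := RN x; rewrite Rx.
by rewrite (PsiE _ _ Rx) -EFinD !lee_fin => H; rewrite addr_ge0// subr_ge0.
Qed.

Lemma Lt_sqr : Lt ^+ 2 = n%:R^-1 * \sum_(i < n) Ls i ^+ 2.
Proof.
by rewrite sqr_sqrtr// mulr_ge0 ?invr_ge0// sumr_ge0// => i _; exact: sqr_ge0.
Qed.

(* [L] may be negative when [d = 0], but then all the points coincide. *)
Lemma stepsize_bound_dist (x y : 'rV[R]_d) :
  gamma / (2 * theta) * ((1 + (s_star r)^-1) * Lt ^+ 2) * norm2 (y - x)
    <= (1 - 2 * gamma * L) * norm2 (y - x) / (2 * gamma).
Proof.
have [->|yx] := eqVneq y x; first by rewrite subrr /norm2 dotv0l !mulr0 mul0r.
rewrite [leRHS]mulrAC; apply: ler_wpM2r; first exact: norm2_ge0.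
apply: stepsize_bound => //; rewrite ?r_gt0 ?sqrtr_ge0//.
exact: lipschitz_const_ge0 g_lip yx.
Qed.

(** Young's inequality with parameter s* for each [i]; the squared Lipschitz constants then average
    to [Lt ^+ 2]. *)
Lemma shift_drift_le x y (u : 'I_n -> 'rV[R]_d) :
  n%:R^-1 * \sum_(i < n) norm2 (u i + (gs i y - gs i x))
    <= (1 + s_star r) * (n%:R^-1 * \sum_(i < n) norm2 (u i))
       + (1 + (s_star r)^-1) * Lt ^+ 2 * norm2 (y - x).
Proof.
have s0 : 0 < s_star r by apply: s_star_gt0; rewrite r_gt0.
have -> (a b c q : R) : a * (n%:R^-1 * b) + c * Lt ^+ 2 * q
    = n%:R^-1 * (a * b + c * ((\sum_(i < n) Ls i ^+ 2) * q)) by rewrite Lt_sqr; ring.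
rewrite ler_wpM2l ?invr_ge0// mulr_suml !mulr_sumr -big_split; apply: ler_sum => i _ /=.
apply: le_trans (norm2D_le _ _ s0) _; rewrite lerD2l ler_wpM2l//.
  by rewrite addr_ge0// invr_ge0 ltW.
exact: lipschitz_norm2.
Qed.

(** The factor [c] stays inside the integral because measurability of [Phi] after a step is not
    established; the induction takes [c = rho ^+ t]. *)
Lemma expected_Psi_step t x hs (c : R) : 0 < c ->
  (\int[P t]_w (c%:E * Phi (step t (x, hs, meanv hs) w))
    <= (c * rho)%:E * Phi (x, hs, meanv hs))%E.
Proof.
move=> c0; have [RN _] := Rf_proper.
case Rx : (Rf x) => [a| |]; last 2 first.
- by rewrite /Phi /Psi Rx sub_Fs gt0_muley ?leey// lte_fin mulr_gt0.
- by have := RN x; rewrite Rx.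
(* [v] is the shift error, [m] the mean of its compression and [N] the centered noise. Then [xi] is
   the error of the gradient estimate, and [e] the shift error after the shifts are updated but
   before the gradients move. *)
pose v i := gs i x - hs i; pose m i := EC t i (v i).
pose N i w := C t w i (v i) - m i.
pose xi w := meanv (fun i => m i - v i) + meanv (fun i => N i w).
pose e i w := v i - lam *: m i + (- lam) *: N i w.
pose S := n%:R^-1 * \sum_(i < n) norm2 (v i).
pose A := c * rho * (meanf fs x + a - Fs).
pose p := c * (gamma / 2).
pose q := c * (gamma / (2 * theta) * (1 + s_star r) / n%:R).
have s0 : 0 < s_star r by apply: s_star_gt0; rewrite r_gt0.
have X0 : 0 <= meanf fs x + a - Fs.
  by have := Fs_le x; rewrite Rx -EFinD lee_fin subr_ge0.
have cN i : centered (P t) (N i) by apply: centered_subE => j; exact: C_int.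
have pointwise w : (c%:E * Phi (step t (x, hs, meanv hs) w)
    <= (A + p * norm2 (xi w) + q * \sum_(i < n) norm2 (e i w))%:E)%E.
  have xiE : meanv hs + meanv (fun i => C t w i (v i)) = meang gs x + xi w.
    rewrite /xi /meang -!meanvD; congr meanv; apply/funext => i.
    by apply/rowP => j; rewrite /N /v !mxE; ring.
  pose k := Num.min 1 (gamma * mu / 2).
  have gm0 : 0 < gamma * mu / 2 by rewrite divr_gt0// mulr_gt0.
  have k01 : 0 < k <= 1 by rewrite lt_min ltr01 gm0 ge_min lexx.
  have kmu : k <= gamma * mu / 2 by rewrite ge_min lexx orbT.
  (* If gamma mu / 2 >= 1 then [k = 1], and 1/2 <= (r + 1) / 2. *)
  have krho : (1 + k)^-1 <= rho.
    rewrite /k; have [h|h] := leP 1 (gamma * mu / 2).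
      apply: (@le_trans _ _ ((r + 1) / 2)); last by rewrite le_max lexx orbT.
      by rewrite -[leLHS]mul1r; apply: ler_wpM2r; rewrite ?invr_ge0// lerDr ltW.
    by rewrite le_max lexx.
  have KL' y u : subdiff Rf y u ->
      ((2 * mu)%:E * ((meanf fs y)%:E + Rf y - Fs%:E) <= (norm2 (meang gs y + u))%:E)%E.
    by move=> /KL; rewrite sub_Fs.
  have [r' Rx' descent] := inexact_prox_gradient_descent
    (continuous_meanf fs_grad) (meanf_gradient_le fs_grad fs_convex) g_lip
    Rf_proper Rf_closed Rf_convex Fs_le gamma_gt0 KL' (xi w)
    prox_spec Rx k01 kmu.
  have -> : step t (x, hs, meanv hs) w = (prox (x - gamma *: (meang gs x + xi w)),
      fun i => hs i + lam *: C t w i (v i), meanv hs + lam *: meanv (fun i => C t w i (v i))).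
    by rewrite -xiE.
  rewrite (PsiE _ _ Rx') -EFinM lee_fin.
  set x' := prox _ in Rx' descent *.
  have drift := shift_drift_le x x' (fun i => e i w).
  have -> : \sum_(i < n) norm2 (gs i x' - (hs i + lam *: C t w i (v i)))
      = \sum_(i < n) norm2 (e i w + (gs i x' - gs i x)).
    apply: eq_bigr => i _; congr norm2.
    by apply/rowP => j; rewrite /e /N /v !mxE; ring.
  (* The step-size bound makes the descent term in |x' - x|^2 absorb the one produced by the
     drift. *)
  have := ler_wpM2l (ltW coef_gt0) drift; have := ler_wpM2r X0 krho.
  have := stepsize_bound_dist x x'; rewrite /A /p /q => H1 H2 H3.
  rewrite -[c * rho * _]mulrA -!(mulrA c) -!mulrDr ler_pM2l//.
  lra.
have S0 : 0 <= S by rewrite mulr_ge0 ?invr_ge0// sumr_ge0// => i _; exact: norm2_ge0.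
(* Bias-variance split: the averaged bias contributes eta^2 and the averaged noise omega_av,
   together r_av. *)
have xi_le : (\int[P t]_w (norm2 (xi w))%:E <= (rav * S)%:E)%E.
  apply: le_trans (integral_norm2_centered_le _ (centered_meanv cN) (C_avg_var t v)) _.
  rewrite lee_fin /rav /rav_const mulrDl -mulrA -/S lerD2r.
  apply: le_trans (norm2_meanv_le _ n_gt0) _.
  rewrite /S mulrCA ler_wpM2l ?invr_ge0// mulr_sumr; apply: ler_sum => i _.
  by apply: norm2_bias_le (C_bias _ _ _); have /andP[] := eta_bounds.
(* The same split per shift: (1 - lam + lam eta)^2 from the mean and lam^2 omega from the noise,
   together [r]. *)
have e_le i : (\int[P t]_w (norm2 (e i w))%:E <= (r * norm2 (v i))%:E)%E.
  have cNl := centeredZ (- lam) (cN i).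
  have Nl := integral_norm2Z_le (- lam) (cN i) (C_var t i (v i)).
  apply: le_trans (integral_norm2_centered_le _ cNl Nl) _.
  rewrite lee_fin /r /r_const mulrDl sqrrN mulrA lerD2r.
  have /andP[e0 _] := eta_bounds; have /andP[l0 l1] := lam_bounds.
  by apply: norm2_sub_scale_le (C_bias _ _ _); rewrite ?(ltW l0).
apply: (@le_trans _ _ (A + p * (rav * S) + q * \sum_(i < n) (r * norm2 (v i)))%:E).
  apply: le_trans (ge0_le_integral_nonmeasurable _ _ pointwise) _.
    by move=> w; rewrite mule_ge0 ?Psi_ge0// lee_fin ltW.
  apply: integral_affine_le => //.
  - by apply: mulr_ge0 => //; apply: mulr_ge0; exact: ltW.
  - by apply: mulr_ge0; [exact: ltW | rewrite divr_ge0// ltW].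
  - apply: mulr_ge0; first exact: ltW.
    rewrite divr_ge0// mulr_ge0//; first exact: ltW coef_gt0.
    by rewrite addr_ge0// ltW.
  - by move=> w; exact: norm2_ge0.
  - exact: centered_measurable_norm2D (centered_meanv cN).
  - by move=> i w; exact: norm2_ge0.
  - by move=> i; exact: centered_measurable_norm2D (centeredZ _ (cN i)).
rewrite (PsiE _ _ Rx) -EFinM lee_fin -mulr_sumr -/S.
rewrite [leRHS](_ : _ = A + rho * (c * (gamma / (2 * theta) * S))); last by rewrite /A; ring.
rewrite -addrA lerD2l.
(* Both error terms are multiples of gamma / (2 theta) S, since gamma / 2 = theta gamma / (2 theta);
   the total factor is (r + 1) / 2 <= [rho]. *)
have -> : p * (rav * S) + q * (r * \sum_(i < n) norm2 (v i))
    = (theta * rav + (1 + s_star r) * r) * (c * (gamma / (2 * theta) * S)).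
  rewrite /p /q /S; field.
  by rewrite pnatr_eq0 -lt0n n_gt0 lt0r_neq0.
rewrite theta_star_contraction ?r_gt0// ler_wpM2r//.
  by apply: mulr_ge0; [exact: ltW | apply: mulr_ge0 => //; exact: ltW coef_gt0].
by rewrite le_max lexx orbT.
Qed.

Lemma EPsi_ge0 k t s : (0 <= EPsi P step Phi k t s)%E.
Proof.
elim: t k s => [|t ih] k s /=; first exact: Psi_ge0.
by apply: integral_ge0 => w _; exact: ih.
Qed.

(** Induction on [t] for all starting iterations and states, as [EPsi] unfolds its first step. The
    invariant that the last state component is the mean of the shifts survives a step by linearity
    of [meanv]. *)
Lemma EPsi_le k t x hs :
  (EPsi P step Phi k t (x, hs, meanv hs) <= (rho ^+ t)%:E * Phi (x, hs, meanv hs))%E.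
Proof.
elim: t k x hs => [|t ih] k x hs; first by rewrite expr0 mul1e.
rewrite -[EPsi _ _ _ _ _ _]/(\int[P k]_w
  EPsi P step Phi k.+1 t (step k (x, hs, meanv hs) w))%E.
have rt0 : 0 <= rho ^+ t by rewrite exprn_ge0// ltW.
apply: (@le_trans _ _ (\int[P k]_w ((rho ^+ t)%:E * Phi (step k (x, hs, meanv hs) w)))%E).
  apply: ge0_le_integral_nonmeasurable => w; first exact: EPsi_ge0.
  pose D i := C k w i (gs i x - hs i).
  have -> : step k (x, hs, meanv hs) w = (prox (x - gamma *: (meanv hs + meanv D)),
      fun i => hs i + lam *: D i, meanv (fun i => hs i + lam *: D i)).
    by rewrite meanvD meanvZ.
  exact: ih.
by rewrite exprSr; apply: expected_Psi_step; rewrite exprn_gt0.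
Qed.

End DianaStep.

Theorem theorem5
  (R : realType) (d n : nat)
  (fs : 'I_n -> 'rV[R]_d -> R) (gs : 'I_n -> 'rV[R]_d -> 'rV[R]_d)
  (Ls : 'I_n -> R) (L : R)
  (Rf : 'rV[R]_d -> \bar R) (xstar : 'rV[R]_d)
  (eta om omav lam gamma mu : R)
  (dO : measure_display) (O : measurableType dO)
  (P : nat -> probability O R)
  (C : nat -> O -> 'I_n -> 'rV[R]_d -> 'rV[R]_d)
  (prox : 'rV[R]_d -> 'rV[R]_d)
  (x0 : 'rV[R]_d) (h0s : 'I_n -> 'rV[R]_d) :
  (0 < n)%N ->
  (* f_i convex, L_i-smooth, with gradient gs i *)
  (forall i, has_gradient (fs i) (gs i)) ->
  (forall i, convex_fun (fs i)) ->
  (forall i, lipschitz_grad (gs i) (Ls i)) ->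
  (* f = 1/n sum f_i is L-smooth with L <= Ltilde *)
  lipschitz_grad (meang gs) L ->
  L <= Num.sqrt (n%:R^-1 * \sum_(i < n) Ls i ^+ 2) ->
  (* R proper closed convex, prox is its proximal operator *)
  proper_fun Rf -> closed_fun Rf -> convex_efun Rf ->
  is_prox gamma Rf prox ->
  (* xstar minimizes f + R *)
  (forall y, ((meanf fs xstar)%:E + Rf xstar <= (meanf fs y)%:E + Rf y)%E) ->
  (* compressors C_i^t in C(eta, omega) *)
  0 <= eta < 1 -> 0 <= om ->
  (forall t i x j, (P t).-integrable setT (fun w => ((C t w i x) 0 j)%:E)) ->
  (forall t i x, enorm (Evec (P t) (fun w => C t w i x) - x) <= eta * enorm x) ->
  (forall t i x, (\int[P t]_w (norm2 (C t w i x - Evec (P t) (fun w => C t w i x)))%:E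
                   <= (om * norm2 x)%:E)%E) ->
  (* omega_av *)
  0 <= omav <= om ->
  (forall t (xs : 'I_n -> 'rV[R]_d),
     (\int[P t]_w (norm2 (meanv (fun i => C t w i (xs i) - Evec (P t) (fun w => C t w i (xs i)))))%:E
       <= (omav / n%:R * \sum_(i < n) norm2 (xs i))%:E)%E) ->
  0 < r_const lam eta om -> 0 < rav_const eta omav ->
  (* Kurdyka-Lojasiewicz condition *)
  0 < mu ->
  (forall x u, subdiff Rf x u ->
     ((2 * mu)%:E * ((meanf fs x)%:E + Rf x - (meanf fs xstar)%:E - Rf xstar)
       <= (norm2 (meang gs x + u))%:E)%E) ->
  (* step sizes *)
  0 < lam <= 1 ->
  r_const lam eta om < 1 ->
  0 < gamma ->
  gamma <= (2 * L + (Num.sqrt (rav_const eta omav / r_const lam eta om))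
                     * (s_star (r_const lam eta om))^-1 * Num.sqrt (n%:R^-1 * \sum_(i < n) Ls i ^+ 2))^-1 ->
  forall t : nat,
    (EPsi P (diana_step gs C prox gamma lam) (Psi fs gs Rf xstar gamma
              (theta_star (r_const lam eta om) (rav_const eta omav)))
          0 t (x0, h0s, meanv h0s)
     <= ((Num.max (1 + gamma * mu / 2)^-1 ((r_const lam eta om + 1) / 2)) ^+ t)%:E
        * Psi fs gs Rf xstar gamma (theta_star (r_const lam eta om) (rav_const eta omav))
              (x0, h0s, meanv h0s))%E.
Proof.
move=> n0 fg fc gL gLip _ Rp Rc Rcv pr xm eb om0 Ci Cb Cv ob Ca r0 rav0 mu0 KL lb r1 g0 gle t.
exact: EPsi_le.
Qed.
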